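(* Let $p$ be an odd prime and let $b$ be a generator of the cyclic group $\mathrm{C}_{4p}$. Then the set of proper skew morphisms of $\mathrm{C}_{4p}$ is exactly the set consisting of all permutations $x_s$ (for $s=4i+2$ with $i\in\{0,\dots,p-1\}$, $i\neq (p-1)/2$), all permutations $y_s$ (for $s=4i$ with $i\in\{1,\dots,p-1\}$), and, if $p\equiv 1 \pmod 4$, also all permutations $z_{\omega,s}$ (for $\omega$ an integer with $\omega^2\equiv -1 \pmod p$ and $s=4i$ with $i\in\{1,\dots,p-1\}$); if $p\equiv 3\pmod 4$ there are no other proper skew morphisms besides the $x_s$ and $y_s$.
   Context: For a finite group $B$, a skew morphism of $B$ is a permutation $\varphi$ of $B$ fixing the identity such that for every $a\in B$ there is a positive integer $i_a$ with $\varphi(ab)=\varphi(a)\varphi^{i_a}(b)$ for all $b\in B$. A skew morphism is proper if it is not a group automorphism of $B$. The permutations are defined as follows, where $t$ ranges over all integers. For $s=4i+2$ ($i\in\{0,\dots,p-1\}$, $i\neq(p-1)/2$): $x_s(b^{2t+1})=b^{2t+1+s}$ and $x_s(b^{2t})=b^{2t}$. For $s=4i$ ($i\in\{1,\dots,p-1\}$): $y_s(b^{2t+1})=b^{2t+1+s}$ and $y_s(b^{2t})=b^{2t}$. For $p\equiv 1\pmod 4$, $\omega$ with $\omega^2\equiv-1\pmod p$, and $s=4i$ ($i\in\{1,\dots,p-1\}$): $z_{\omega,s}(b^{4t+1})=b^{4t+1+s}$, $z_{\omega,s}(b^{4t+2})=b^{4t+2+s(\omega+1)}$, $z_{\omega,s}(b^{4t+3})=b^{4t+3+s\omega}$,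 $z_{\omega,s}(b^{4t})=b^{4t}$. *)

(* Defs.v *)
From HB Require Import structures.
From mathcomp Require Import all_boot all_order all_algebra all_fingroup.
From mathcomp Require Import cyclic.
From mathcomp Require Import zify ring.

Set Implicit Arguments.
Unset Strict Implicit.
Unset Printing Implicit Defensive.

Import Order.TTheory GRing.Theory Num.Theory.

(* The finite group B is the whole of gT.  The power (phi ^+ i)%g is taken in
   {perm gT}, where it is the i-fold composite of phi. *)
Definition skew_morphism (gT : finGroupType) (phi : {perm gT}) : Prop :=
  phi 1%g = 1%g /\
  forall a : gT, exists i : nat,
    (0 < i)%N /\ forall b : gT, phi (a * b)%g = (phi a * (phi ^+ i)%g b)%g.

Definition proper_skew_morphism (gT : finGroupType) (phi : {perm gT}) : Prop :=
  skew_morphism phi /\ phi \notin Aut [set: gT].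

Definition zexpg (gT : finGroupType) (g : gT) (k : int) : gT :=
  match k with
  | Posz n => (g ^+ n)%g
  | Negz n => (g ^- n.+1)%g
  end.

Local Open Scope ring_scope.

(* x_s and y_s are given by the same formula; they differ only in whether
   s = 2 or s = 0 modulo 4. *)
Definition is_xy_perm (gT : finGroupType) (b : gT) (s : int)
    (phi : {perm gT}) : Prop :=
  forall t : int,
    phi (zexpg b (2 * t + 1)) = zexpg b (2 * t + 1 + s) /\
    phi (zexpg b (2 * t)) = zexpg b (2 * t).

Definition is_z_perm (gT : finGroupType) (b : gT) (w s : int)
    (phi : {perm gT}) : Prop :=
  forall t : int,
    [/\ phi (zexpg b (4 * t + 1)) = zexpg b (4 * t + 1 + s),
        phi (zexpg b (4 * t + 2)) = zexpg b (4 * t + 2 + s * (w + 1)),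
        phi (zexpg b (4 * t + 3)) = zexpg b (4 * t + 3 + s * w) &
        phi (zexpg b (4 * t)) = zexpg b (4 * t)].

(* The formulas above define permutations: when b generates gT and 4 divides
   the order of gT, exactly one phi satisfies each of them. *)

Lemma zexpg_mod (gT : finGroupType) (b : gT) (k : int) :
  zexpg b k = (b ^+ `|(k %% #[b]%g)%Z|)%g.
Proof.
case: k => n /=; first by rewrite modz_nat absz_nat expg_mod_order.
rewrite modNz_nat ?order_gt0 //.
have lt_nb : (n %% #[b]%g < #[b]%g)%N by rewrite ltn_mod order_gt0.
have absE : `|(#[b]%g%:Z - 1 - (n %% #[b]%g)%N%:Z : int)|%N
          = (#[b]%g - (n %% #[b]%g).+1)%N by lia.
apply: (mulIg (b ^+ n.+1)%g); rewrite mulVg absE -expgD.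
have -> : (#[b]%g - (n %% #[b]%g).+1 + n.+1 = #[b]%g * (n %/ #[b]%g).+1)%N.
  by rewrite mulnS [in LHS](divn_eq n #[b]%g) modnMDl modn_mod; lia.
by rewrite expgM expg_order expg1n.
Qed.

Lemma eq_zexpg (gT : finGroupType) (b : gT) (k l : int) :
  (zexpg b k == zexpg b l) = (k == l %[mod #[b]%g])%Z.
Proof.
have b0 : (#[b]%g%:Z != 0 :> int) by have := order_gt0 b; lia.
have ltb : 0 < #[b]%g%:Z :> int by have := order_gt0 b; lia.
rewrite !zexpg_mod eq_expg_mod_order.
have := modz_ge0 k b0; have := modz_ge0 l b0.
have := ltz_pmod k ltb; have := ltz_pmod l ltb.
set x := (k %% _)%Z; set y := (l %% _)%Z => ? ? ? ?.
rewrite !modn_small; lia.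
Qed.

Lemma zexpg_onto (gT : finGroupType) (b : gT) :
  generator [set: gT] b -> forall g : gT, exists k : int, zexpg b k == g.
Proof.
move=> /eqP genb g; have : g \in [set: gT] by rewrite inE.
by rewrite genb => /cycleP[n ->]; exists n%:Z.
Qed.

Lemma shift_perm (gT : finGroupType) (b : gT) (m : nat) (d : int -> int) :
    generator [set: gT] b -> (m %| #|gT|)%N ->
    (forall k, (m %| d k)%Z) ->
    (forall k l, (k == l %[mod m])%Z -> d k = d l) ->
  exists phi : {perm gT}, forall k, phi (zexpg b k) = zexpg b (k + d k).
Proof.
move=> genb; have ob : #|gT| = #[b]%g.
  by rewrite -cardsT (eqP genb).
rewrite ob => mb md dmod.
pose lg g := xchoose (zexpg_onto genb g).
have lgK g : zexpg b (lg g) = g by apply/eqP; apply: (xchooseP (zexpg_onto genb g)).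
have modm k l : (k == l %[mod #[b]%g])%Z -> (k == l %[mod m])%Z.
  by rewrite !eqz_mod_dvd; apply: dvdz_trans.
pose f g := zexpg b (lg g + d (lg g)).
have f_inj : injective f.
  move=> g h /eqP; rewrite eq_zexpg => E.
  have dE : d (lg g) = d (lg h).
    apply: dmod; have := modm _ _ E; rewrite !eqz_mod_dvd.
    have -> : lg g + d (lg g) - (lg h + d (lg h))
              = (lg g - lg h) + (d (lg g) - d (lg h)) by ring.
    by rewrite rpredDr // rpredB.
  move: E; rewrite dE eqz_modDr => E.
  by rewrite -[g]lgK -[h]lgK; apply/eqP; rewrite eq_zexpg.
exists (perm f_inj) => k; rewrite permE /f.
have E : (lg (zexpg b k) == k %[mod #[b]%g])%Z by rewrite -eq_zexpg lgK.
by rewrite (dmod _ _ (modm _ _ E)); apply/eqP; rewrite eq_zexpg eqz_modDr.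
Qed.

Lemma is_xy_perm_exists (gT : finGroupType) (b : gT) (s : int) :
    generator [set: gT] b -> (4 %| #|gT|)%N -> (2 %| s)%Z ->
  exists! phi : {perm gT}, is_xy_perm b s phi.
Proof.
move=> genb d4 s2.
have [|||phi phiE] := @shift_perm gT b 2
  (fun k => if (k %% 2)%Z == 0 then 0 else s) genb.
- exact: dvdn_trans d4.
- by move=> k; case: ifP.
- by move=> k l /eqP->.
exists phi; split=> [t|psi psiP].
  rewrite !phiE ifF; last by lia.
  by rewrite ifT ?addr0 //; lia.
apply/permP=> g; have [k /eqP<-] := zexpg_onto genb g.
have [/eqP k0|k0] := boolP ((k %% 2)%Z == 0).
  have -> : k = 2 * (k %/ 2)%Z by lia.
  by rewrite (psiP _).2 phiE ifT ?addr0 //; lia.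
have -> : k = 2 * (k %/ 2)%Z + 1 by lia.
by rewrite (psiP _).1 phiE ifF //; lia.
Qed.

Lemma is_z_perm_exists (gT : finGroupType) (b : gT) (w s : int) :
    generator [set: gT] b -> (4 %| #|gT|)%N -> (4 %| s)%Z ->
  exists! phi : {perm gT}, is_z_perm b w s phi.
Proof.
move=> genb d4 s4.
have [|||phi phiE] := @shift_perm gT b 4
  (fun k => let r := (k %% 4)%Z in
     if r == 0 then 0 else if r == 1 then s
     else if r == 2 then s * (w + 1) else s * w) genb.
- exact: d4.
- by move=> k /=; do 3?case: ifP => // _; rewrite ?dvdz_mulr.
- by move=> k l /eqP/= ->.
have phi0 t : phi (zexpg b (4 * t)) = zexpg b (4 * t).
  by rewrite phiE /= ifT ?addr0 //; lia.
have phi1 t : phi (zexpg b (4 * t + 1)) = zexpg b (4 * t + 1 + s).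
  by rewrite phiE; have -> : ((4 * t + 1) %% 4)%Z = 1 by lia.
have phi2 t : phi (zexpg b (4 * t + 2)) = zexpg b (4 * t + 2 + s * (w + 1)).
  by rewrite phiE; have -> : ((4 * t + 2) %% 4)%Z = 2 by lia.
have phi3 t : phi (zexpg b (4 * t + 3)) = zexpg b (4 * t + 3 + s * w).
  by rewrite phiE; have -> : ((4 * t + 3) %% 4)%Z = 3 by lia.
exists phi; split=> [t|psi psiP]; first by split.
apply/permP=> g; have [k /eqP<-] := zexpg_onto genb g.
have [psi1 psi2 psi3 psi0] := psiP (k %/ 4)%Z.
have : (k = 4 * (k %/ 4)%Z \/ k = 4 * (k %/ 4)%Z + 1) \/
       (k = 4 * (k %/ 4)%Z + 2 \/ k = 4 * (k %/ 4)%Z + 3) by lia.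
by case=> -[] ->; rewrite ?phi0 ?phi1 ?phi2 ?phi3 ?psi0 ?psi1 ?psi2 ?psi3.
Qed.

(* Main.v *)
(* Transported to exponents, a skew morphism is a map f on the integers modulo
   n = 4p, and its kernel is the set of d with f (d + b) = f d + f b.  Since f
   is determined by its values on the orbit of the generator 1, its order is
   smaller than n, and the pigeonhole principle makes the kernel nontrivial: it
   contains some d = n/q with q prime, and the same f is then a skew morphism
   modulo d.  Descending through 2p, p and 4 (and through the restriction of f
   to even numbers) shows that 4 always lies in the kernel modulo 4p, where f
   acts on Z/4 as 1 or -1.  A power f^e acts as b |-> b + 4 g(b) with
   g(1 + b) = g(1) + x g(b) modulo p; as g has period 4, either g(1) = 0 and f
   is an automorphism, or (1 + x)(1 + x^2) = 0 modulo p.  The root x = -1 yields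
   the permutations x_s and y_s, the roots of x^2 = -1 yield z_{x,s}. *)

Require Import Defs.
From mathcomp Require Import all_boot all_order all_algebra all_fingroup.
From mathcomp Require Import cyclic zify ring.
From Stdlib Require Import Setoid Morphisms Classical.

Set Implicit Arguments.
Unset Strict Implicit.
Unset Printing Implicit Defensive.

Import Order.TTheory GRing.Theory Num.Theory.

Local Open Scope ring_scope.

(** * Congruences, and skew morphisms as maps on exponents *)

Definition eqm (n : nat) (a b : int) : Prop := (n %| a - b)%Z.

Lemma eqm_refl n a : eqm n a a.
Proof. by rewrite /eqm subrr dvdz0. Qed.

#[local] Hint Resolve eqm_refl : core.

Lemma eqm_sym n a b : eqm n a b -> eqm n b a.
Proof. by rewrite /eqm -opprB rpredN. Qed.

Lemma eqm_trans n a b c : eqm n a b -> eqm n b c -> eqm n a c.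
Proof. by rewrite /eqm => ab /(rpredD ab); rewrite addrA subrK. Qed.

#[local] Instance eqm_equiv n : Equivalence (eqm n).
Proof. split; [exact: eqm_refl | exact: eqm_sym | exact: eqm_trans]. Qed.

#[local] Instance eqm_add n :
  Proper (eqm n ==> eqm n ==> eqm n) (@GRing.add int).
Proof. move=> a b ab c d cd; rewrite /eqm opprD addrACA; exact: rpredD. Qed.

#[local] Instance eqm_opp n : Proper (eqm n ==> eqm n) (@GRing.opp int).
Proof. by move=> a b ab; rewrite /eqm -opprD rpredN. Qed.

#[local] Instance eqm_mul n :
  Proper (eqm n ==> eqm n ==> eqm n) (@GRing.mul int).
Proof.
move=> a b ab c d cd.
rewrite /eqm (_ : a * c - b * d = (a - b) * c + b * (c - d)); last by ring.
by apply: rpredD; [exact: dvdz_mulr | exact: dvdz_mull].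
Qed.

Lemma eqm0 n a : eqm n a 0 <-> (n %| a)%Z.
Proof. by rewrite /eqm subr0. Qed.

Lemma eqm_mod n a b : eqm n a b <-> (a = b %[mod n])%Z.
Proof. by rewrite /eqm -eqz_mod_dvd; split=> [/eqP|->]. Qed.

Lemma eqm_dvd m n a b : (m %| n)%N -> eqm n a b -> eqm m a b.
Proof. by move=> mn; apply: dvdz_trans. Qed.

Lemma eqm_addI n a b c : eqm n (a + b) (a + c) -> eqm n b c.
Proof. by rewrite /eqm (_ : a + b - (a + c) = b - c); last by ring. Qed.

Lemma eqm_scale (d q : nat) a b :
  (0 < d)%N -> eqm (q * d) (d%:Z * a) (d%:Z * b) <-> eqm q a b.
Proof.
by move=> d0; rewrite /eqm -mulrBr mulnC PoszM dvdz_mul2l //; lia.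
Qed.

Lemma eqm_lin (n : nat) k a b : a = b + k * n%:Z -> eqm n a b.
Proof. by move=> ->; rewrite /eqm addrC addKr dvdz_mull. Qed.

Lemma prime_dvdzM (p : nat) a b :
  prime p -> (p %| a * b)%Z -> (p %| a)%Z \/ (p %| b)%Z.
Proof. by move=> pp; rewrite !dvdzE abszM Euclid_dvdM // => /orP. Qed.

(** Bijectivity modulo [n] is encoded by a common period of all points, so that inverses are again
    iterates. *)
Record skewz (n : nat) (f : int -> int) : Prop := Skewz {
  skewz_eqm : forall a b, eqm n a b -> eqm n (f a) (f b);
  skewz_period : exists M, (0 < M)%N /\ forall a, eqm n (iter M f a) a;
  skewz0 : eqm n (f 0) 0;
  skewzD : forall a, exists j, (0 < j)%N /\
             forall b, eqm n (f (a + b)) (f a + iter j f b) }.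

Definition homz n (f : int -> int) := forall a b, eqm n (f (a + b)) (f a + f b).

Definition kerz n (f : int -> int) d :=
  forall b, eqm n (f (d + b)) (f d + f b).

(** Euclidean descent: if [P k] holds and [M] does not divide [k], then [k %% M] is a smaller
    positive candidate. Since [P] may be undecidable, the case split is classical. *)
Lemma exists_minimal_period (P : nat -> Prop) M :
    (forall a b, P a -> P (a + b)%N <-> P b) -> (0 < M)%N -> P M ->
  exists m, [/\ (0 < m)%N, P m & forall k, P k <-> (m %| k)%N].
Proof.
move=> Padd; have [n leMn] := ubnP M; elim: n M leMn => // n IH M leMn M0 PM.
have P0 : P 0%N by apply/(Padd _ 0%N PM); rewrite addn0.
have Pmul k : P (k * M)%N.
  by elim: k => [|k IHk]; rewrite ?mul0n // mulSn; apply/Padd.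
have [[k [Pk kM]]|noP] := classic (exists k, P k /\ ~~ (M %| k)%N).
  apply: (IH (k %% M)%N); first by have := ltn_pmod k M0; lia.
    by rewrite lt0n.
  by apply/(Padd _ _ (Pmul (k %/ M)%N)); rewrite -divn_eq.
exists M; split=> // k; split=> [Pk|/dvdnP[q ->] //].
by apply/negPn/negP=> kM; apply: noP; exists k.
Qed.

(** * Orbits, and nontriviality of the kernel *)

Section Skewz.

Variables (n : nat) (f : int -> int).
Hypotheses (n_gt0 : (0 < n)%N) (sk : skewz n f).

#[local] Instance skewz_proper : Proper (eqm n ==> eqm n) f.
Proof. move=> a b; exact: (skewz_eqm sk). Qed.

#[local] Instance iter_proper k : Proper (eqm n ==> eqm n) (iter k f).
Proof. by move=> a b ab; elim: k => //= k IH; rewrite IH. Qed.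

Lemma iter_skewz0 k : eqm n (iter k f 0) 0.
Proof. elim: k => [|k IH];[by []|by rewrite iterS IH skewz0]. Qed.

Lemma iter_skewzD k a : exists s, forall b,
  eqm n (iter k f (a + b)) (iter k f a + iter s f b).
Proof.
elim: k => [|k [s IH]]; first by exists 0%N => b /=.
have [j [_ fj]] := skewzD sk (iter k f a).
by exists (j + s)%N => b; rewrite !iterS IH fj iterD.
Qed.

Lemma iter_mul_id m k c : eqm n (iter m f c) c -> eqm n (iter (k * m) f c) c.
Proof. by move=> fm; elim: k => // k IH; rewrite mulSn iterD IH. Qed.

Lemma exists_orbit_period (P : int -> Prop) :
  exists m, (0 < m)%N /\
    forall k, (forall c, P c -> eqm n (iter k f c) c) <-> (m %| k)%N.
Proof.
have [M [M0 fM]] := skewz_period sk.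
have [||m [m0 _ mP]] := @exists_minimal_period
  (fun k => forall c, P c -> eqm n (iter k f c) c) M _ M0; last by exists m.
  move=> a b Pa; split=> H c Pc; have := H c Pc.
    rewrite addnC iterD => E.
    by rewrite -[X in eqm n _ X]E (Pa _ Pc).
  by move=> E; rewrite addnC iterD Pa.
by move=> c _.
Qed.

(* The stabiliser of 1 in the cyclic group <f> is normalised by the
   translations: if f^m fixes 1, then f^m (1 + c) = 1 + f^s c with m | s. *)
Lemma orbit1_faithful m : (0 < m)%N ->
    (forall k, eqm n (iter k f 1) 1 <-> (m %| k)%N) ->
  forall c, eqm n (iter m f c) c.
Proof.
move=> m0 mP; have fm1 : eqm n (iter m f 1) 1 by apply/mP.
have [M [M0 MP]] := exists_orbit_period (fun=> True).
have fM k : (M %| k)%N -> forall c, eqm n (iter k f c) c.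
  by move=> /MP H c; apply: H.
have /dvdnP[r Mr] : (m %| M)%N by apply/mP; apply: fM.
have [s fs] := iter_skewzD m 1; have {}fs c : eqm n (iter m f (1 + c)) (1 + iter s f c).
  by rewrite fs fm1.
have fsk k c : eqm n (iter (k * m) f (1 + c)) (1 + iter (k * s) f c).
  elim: k => [|k IH]; first by reflexivity.
  by rewrite !mulSn iterD IH fs iterD.
(* By [fsk] with [k = r], the iterate of order [r * m = M] being trivial makes the one of order
   [r * s] trivial; so [r * m] divides [r * s]. *)
have /dvdnP[t st] : (m %| s)%N.
  have /MP : forall c, True -> eqm n (iter (r * s) f c) c.
    move=> c _; apply: (@eqm_addI n 1); rewrite -fsk -Mr fM //.
  by rewrite Mr dvdn_pmul2l //; lia.
have step c : eqm n (iter m f c) c -> eqm n (iter m f (1 + c)) (1 + c).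
  by move=> fc; rewrite fs st iter_mul_id //.
have nat_fix (k : nat) : eqm n (iter m f k) k.
  elim: k => [|k IH]; first exact: iter_skewz0.
  by rewrite (_ : k.+1%:Z = 1 + k%:Z); [exact: step | lia].
move=> c; have cE : eqm n c `|(c %% n)%Z|%N.
  apply: (@eqm_lin _ (c %/ n)%Z); rewrite gez0_abs ?modz_ge0 //; last by lia.
  by rewrite addrC -divz_eq.
by rewrite cE.
Qed.

(** The period gives a left inverse: [k * M.-1] further iterations complete [k * M] of them. *)
Lemma iter_skewz_inj k a b : eqm n (iter k f a) (iter k f b) -> eqm n a b.
Proof.
have [M [M0 fM]] := skewz_period sk.
have fkM c : eqm n (iter (k * M.-1) f (iter k f c)) c.
  rewrite -iterD -mulnSr prednK //; exact: iter_mul_id.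
by move=> E; rewrite -[a]fkM E fkM.
Qed.

Lemma eqm_small_nat a : exists r : nat, (r < n)%N /\ eqm n a r.
Proof.
have nn : (n%:Z != 0 :> int) by lia.
have r0 := modz_ge0 a nn.
exists `|(a %% n)%Z|%N; split; first by have := @ltz_pmod a n; lia.
by apply: (@eqm_lin _ (a %/ n)%Z); rewrite gez0_abs // addrC -divz_eq.
Qed.

(** The exponent attached to [a] matters only modulo the length [m] of the orbit of 1, which is
    below [n] because the orbit avoids 0. Hence two of the [n] residues share an exponent, and their
    difference lies in the kernel. *)
Lemma kerz_exists : (1 < n)%N -> exists d : nat, [/\ (0 < d)%N, (d < n)%N & kerz n f d].
Proof.
move=> n1.
have [m [m0 mP0]] := exists_orbit_period (fun c => c = 1).
have mP k : eqm n (iter k f 1) 1 <-> (m %| k)%N.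
  by rewrite -mP0; split=> [E c -> //|]; apply.
have fm := orbit1_faithful m0 mP.
have ltmn : (m < n)%N.
  pose r i := `|(iter i f 1 %% n)%Z|%N.
  have r0 i : 0 <= (iter i f 1 %% n)%Z by apply: modz_ge0; lia.
  have ri i : eqm n (iter i f 1) (r i).
    apply: (@eqm_lin _ (iter i f 1 %/ n)%Z).
    by rewrite gez0_abs // addrC -divz_eq.
  suff : (size [seq r i | i <- iota 0 m] <= size (iota 1 n.-1))%N.
    by rewrite size_map !size_iota; lia.
  apply: uniq_leq_size => [|x /mapP[i _ ->]].
    rewrite map_inj_in_uniq ?iota_uniq // => i j; rewrite !mem_iota => im jm E.
    have {}E : eqm n (iter i f 1) (iter j f 1) by rewrite !ri E.
    wlog le_ij : i j im jm E / (i <= j)%N.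
      move=> W; case/orP: (leq_total i j) => ij; first exact: W.
      by symmetry; apply: W => //; rewrite E.
    have /mP/dvdnP[[|q]] : eqm n (iter (j - i) f 1) 1; try nia.
    apply: (@iter_skewz_inj i); rewrite -iterD subnKC //; exact: eqm_sym.
  rewrite mem_iota; have := ltz_pmod (iter i f 1) (_ : 0 < n%:Z).
  suff : r i <> 0%N by have := r0 i; rewrite /r; lia.
  move=> E; have := ri i; rewrite E -[X in eqm n _ X](iter_skewz0 i).
  by move/iter_skewz_inj; rewrite eqm0 dvdzE dvdn1; lia.
have ex (a : 'I_n) : exists k : 'I_m,
    forall b, eqm n (f (a%:Z + b)) (f a%:Z + iter k f b).
  have [j [_ fj]] := skewzD sk a%:Z.
  exists (Ordinal (ltn_pmod j m0)) => b /=.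
  by rewrite fj [in iter j f b](divn_eq j m) iterD iter_mul_id //; exact: fm.
have [h hP] := fin_all_exists ex.
have /injectivePn[x [y nxy E]] : ~~ injectiveb h.
  by apply/injectiveP => /leq_card; rewrite !card_ord; lia.
wlog lt_yx : x y nxy E / (y < x)%N.
  move=> W; case: (ltngtP x y) => xy; first by apply: (W y x) => //; rewrite eq_sym.
    exact: (W x y).
  by case/eqP: nxy; apply: val_inj.
(* Both [x + (c - y)] and [y + (c - y)] are expanded with the same exponent, so the iterated term
   cancels. *)
have fd c : eqm n (f ((x - y)%N%:Z + c)) (f x%:Z - f y%:Z + f c).
  have -> : (x - y)%N%:Z + c = x%:Z + (c - y%:Z) by lia.
  have {2}-> : c = y%:Z + (c - y%:Z) by ring.
  by rewrite !hP E addrA subrK.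
exists (x - y)%N; split; first (by rewrite subn_gt0); first by have := ltn_ord x; lia.
have fd0 : eqm n (f (x - y)%N%:Z) (f x%:Z - f y%:Z).
  by rewrite -[Posz (x - y)]addr0 fd skewz0 // addr0.
by move=> c; rewrite fd fd0.
Qed.

Lemma kerz_lin d : kerz n f d ->
  forall b k, eqm n (f (b + d * k)) (f b + f d * k).
Proof.
move=> kd b; elim=> [|k IH|k IH]; first by rewrite !mulr0 !addr0.
  have -> : b + d * k.+1%:Z = d + (b + d * k%:Z) by rewrite intS; ring.
  have -> : f b + f d * k.+1%:Z = f d + (f b + f d * k%:Z) by rewrite intS; ring.
  by rewrite kd IH.
apply: (@eqm_addI _ (f d)); rewrite -kd.
have -> : d + (b + d * (- k.+1%:Z)) = b + d * - k%:Z by rewrite intS; ring.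
have -> : f d + (f b + f d * (- k.+1%:Z)) = f b + f d * - k%:Z by rewrite intS; ring.
exact: IH.
Qed.

Lemma kerzM d k : kerz n f d -> kerz n f (d * k).
Proof.
move=> kd b; rewrite addrC (kerz_lin kd) -[in f (d * k)](add0r (d * k)).
by rewrite (kerz_lin kd) skewz0 // add0r addrC.
Qed.

Lemma kerz_eqm a b : eqm n a b -> kerz n f a -> kerz n f b.
Proof. by move=> ab ka c; rewrite -ab. Qed.

(** The kernel is closed under integer multiples, so by Bezout it contains the proper divisor
    [gcdn n c] of [n], and then a multiple of it with prime cofactor. *)
Lemma prime_kerz : (1 < n)%N ->
  exists q d : nat, [/\ prime q, n = (q * d)%N & kerz n f d].
Proof.
move=> n1; have [c [c0 ltc kc]] := kerz_exists n1.
have [a _ /dvdnP[t at_]] := @Bezoutl n c n_gt0.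
pose q := pdiv (n %/ gcdn n c).
have nG : (n = n %/ gcdn n c * gcdn n c)%N by rewrite divnK // dvdn_gcdl.
have G1 : (gcdn n c < n)%N by apply: leq_ltn_trans ltc; apply: dvdn_leq (dvdn_gcdr _ _).
have nG1 : (1 < n %/ gcdn n c)%N by rewrite ltn_divRL ?dvdn_gcdl // mul1n.
have /dvdnP[s sE] : (q %| n %/ gcdn n c)%N by apply: pdiv_dvd.
exists q, (s * gcdn n c)%N; split; first exact: pdiv_prime.
  by rewrite {1}nG sE; lia.
apply: kerz_eqm (kerzM (- a%:Z * s%:Z) kc).
apply: (@eqm_lin _ (- t%:Z * s%:Z)).
have : (gcdn n c)%:Z + a%:Z * c%:Z = t%:Z * n%:Z by lia.
move=> E; have GE : (gcdn n c)%:Z = t%:Z * n%:Z - a%:Z * c%:Z by lia.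
by rewrite PoszM GE; ring.
Qed.

Section Quotient.

Variables (q d : nat).
Hypotheses (nE : n = (q * d)%N) (kd : kerz n f d).

(** Since [d * q] is 0 modulo [n], so is [f d * q]; therefore [d] divides [f d], and [u] is the
    quotient. *)
Lemma kerz_quotient_multiplier : exists u, forall b k,
  eqm n (f (b + d%:Z * k)) (f b + d%:Z * u * k).
Proof.
have dq0 : eqm n (d%:Z * q%:Z) 0 by rewrite eqm0 nE -PoszM mulnC.
have /dvdzP[u fd] : (d %| f d)%Z.
  have := kerz_lin kd 0 q%:Z; rewrite add0r dq0 skewz0 // add0r => /eqm_sym.
  by rewrite eqm0 nE mulnC PoszM dvdz_mul2r //; nia.
by exists u => b k; rewrite [d%:Z * u]mulrC -fd; exact: (kerz_lin kd).
Qed.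

Lemma skewz_quotient : skewz d f.
Proof.
have [u fu] := kerz_quotient_multiplier.
have dn : (d %| n)%N by rewrite nE dvdn_mull.
split=> [a b /dvdzP[k E]||| a].
- have -> : a = b + d%:Z * k by rewrite -[a](subrK b) E; ring.
  by rewrite (eqm_dvd dn (fu _ _)); apply: (@eqm_lin _ (u * k)); ring.
- by have [M [M0 fM]] := skewz_period sk; exists M; split=> // a; apply: eqm_dvd (fM a).
- exact: eqm_dvd (skewz0 sk).
by have [j [j0 fj]] := skewzD sk a; exists j; split=> // b; apply: eqm_dvd (fj b).
Qed.

End Quotient.

End Skewz.

Existing Class skewz.
#[local] Existing Instances skewz_proper iter_proper.

Lemma eqm_expr n (a b : int) k : eqm n a b -> eqm n (a ^+ k) (b ^+ k).
Proof. by move=> ab; elim: k => // k IH; rewrite !exprS; apply: eqm_mul. Qed.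

(** * Lifting from modulus [d] to modulus [q * d] *)

Section Extension.

Variables (n q d : nat) (f : int -> int).
Hypotheses (n_gt0 : (0 < n)%N) (sk : skewz n f) (nE : n = (q * d)%N).
Hypotheses (kd : kerz n f d) (hd : homz d f).

Let dn : (d %| n)%N. Proof. by rewrite nE dvdn_mull. Qed.
Let d_gt0 : (0 < d)%N. Proof. by move: n_gt0; rewrite nE muln_gt0 => /andP[]. Qed.

Let scale a b : eqm n (d%:Z * a) (d%:Z * b) <-> eqm q a b.
Proof. by rewrite nE; exact: eqm_scale. Qed.

(* [e] is the order of [f] acting on Z/d and on dZ/n simultaneously. *)
Lemma kerz_extension : exists (u : int) (e : nat) (g : int -> int),
  [/\ (0 < e)%N,
      forall b k, eqm n (f (b + d%:Z * k)) (f b + d%:Z * u * k),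
      forall b, iter e f b = b + d%:Z * g b &
      forall k, (forall b, eqm d (iter k f b) b) -> eqm q (u ^+ k) 1 ->
        (e %| k)%N] /\
  [/\ forall b k, eqm q (g (b + d%:Z * k)) (g b),
      forall a, exists x : nat, forall b, eqm q (g (a + b)) (g a + x%:Z * g b),
      forall a, exists x : nat, forall b,
        eqm n (f (a + b)) (f a + f b + d%:Z * u * (x%:Z * g b)) &
      forall b, eqm q (g (f b)) (u * g b)].
Proof.
have skd : skewz d f := skewz_quotient n_gt0 sk nE kd.
have [u fu] := kerz_quotient_multiplier n_gt0 sk nE kd.
have fku k b c : eqm n (iter k f (b + d%:Z * c)) (iter k f b + d%:Z * (u ^+ k * c)).
  elim: k => [|k IH]; first by rewrite expr0 mul1r.
  by rewrite !iterS IH fu exprS !mulrA.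
pose P k := (forall b, eqm d (iter k f b) b) /\ eqm q (u ^+ k) 1.
have [M [M0 fM]] := skewz_period sk.
have [||e [e0 [fe ue] Pe]] := @exists_minimal_period P M _ M0.
- move=> a b [fa ua]; rewrite /P exprD; split=> -[fb ub].
    by split=> [c|]; [have := fb c; rewrite iterD fa | rewrite -ub ua mul1r].
  by split=> [c|]; [rewrite iterD fa | rewrite ub ua mul1r].
- split=> [b|]; first exact: eqm_dvd (fM b).
  apply/scale; have := fM (0 + d%:Z * 1); rewrite fku (iter_skewz0 sk) add0r mulr1.
  by rewrite add0r mulr1.
have due c : eqm n (d%:Z * (u ^+ e * c)) (d%:Z * c) by apply/scale; rewrite ue mul1r.
(* The division is exact because the [e]-th iterate is the identity modulo [d]. *)
pose g b := ((iter e f b - b) %/ d)%Z.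
have gE b : iter e f b = b + d%:Z * g b.
  by rewrite mulrC divzK ?subrKC //; exact: fe.
have fkE k : (e %| k)%N -> exists x : nat, forall b,
    eqm n (iter k f b) (b + d%:Z * (x%:Z * g b)).
  move=> /dvdnP[x ->]; exists x => b.
  elim: x => [|x IH]; first by rewrite mul0r mulr0 addr0.
  rewrite mulSn iterD IH fku gE due; apply: (@eqm_lin _ 0); rewrite intS; ring.
exists u, e, g; split; split=> //.
- by move=> k fk uk; apply/Pe.
- move=> b k; apply/scale; apply: (@eqm_addI _ (b + d%:Z * k)).
  by rewrite -gE fku gE due; apply: (@eqm_lin _ 0); ring.
- move=> a; have [s fs] := iter_skewzD sk e a.
  (* Reduction modulo [d] shows that the [s]-th iterate is trivial there; the choice [b = d] shows
     that [u ^+ s] is 1 modulo [q]. *)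
  have /fkE[x fx] : (e %| s)%N.
    apply/Pe; split=> [b|].
      by have := eqm_dvd dn (fs b); rewrite !fe => /eqm_addI/eqm_sym.
    apply/scale; have := fs (0 + d%:Z * 1).
    rewrite addrA addr0 !fku due (iter_skewz0 sk) add0r => /eqm_addI.
    by rewrite !mulr1; exact: eqm_sym.
  exists x => b; apply/scale; apply: (@eqm_addI _ (a + b)).
  by rewrite -gE fs fx gE; apply: (@eqm_lin _ 0); ring.
- move=> a; have [[|j] [j0 fj]] := skewzD sk a; first by [].
  (* Additivity modulo [d] makes the exponent [j.+1] act like 1 there, and [b = d] gives
     [u ^+ j.+1 = u] modulo [q]. Cancelling one [f], respectively one [u], shows that [j] is a
     multiple of [e]. *)
  have /fkE[x fx] : (e %| j)%N.
    apply/Pe; split=> [b|].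
      apply: (iter_skewz_inj skd (k := 1%N)); rewrite //= -iterS.
      apply: (@eqm_addI _ (f a)); rewrite -(eqm_dvd dn (fj b)); exact: hd.
    have uj : eqm q (u ^+ j.+1) u.
      apply/scale; have := fj (0 + d%:Z * 1).
      rewrite addrA addr0 fu fku (iter_skewz0 sk) add0r !mulr1 => /eqm_addI.
      exact: eqm_sym.
    have uV : u ^+ e = u * u ^+ e.-1 by rewrite -exprS prednK.
    rewrite -[u ^+ j]mulr1 -{1}ue uV mulrA -exprSr uj -uV ue //.
  by exists x => b; rewrite fj iterS fx fu addrA.
- move=> b; apply/scale; apply: (@eqm_addI _ (f b)).
  by rewrite -gE -iterSr iterS gE fu mulrA.
Qed.

End Extension.

(** * Small moduli, and 4 in the kernel modulo [4 * p] *)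

Lemma skewz_inj n f a b : skewz n f -> eqm n (f a) (f b) -> eqm n a b.
Proof. by move=> sk; exact: (iter_skewz_inj sk (k := 1%N)). Qed.

Lemma kerz1_lin n f : skewz n f -> kerz n f 1 -> forall a, eqm n (f a) (f 1 * a).
Proof.
move=> sk k1 a; have := kerz_lin k1 0 a.
by rewrite add0r mul1r (skewz0 sk) add0r.
Qed.

Lemma lin_homz n f u : (forall a, eqm n (f a) (u * a)) -> homz n f.
Proof. by move=> fu a b; rewrite !fu mulrDr. Qed.

Lemma skewz_prime_homz p f : prime p -> skewz p f -> homz p f.
Proof.
move=> pp sk; have [q [d [pq pE kd]]] := prime_kerz (prime_gt0 pp) sk (prime_gt1 pp).
have d1 : d = 1%N.
  move: pp; rewrite pE => /primeP[_ /(_ q (dvdn_mulr d (dvdnn q)))].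
  by have := prime_gt1 pq => q1 /orP[] /eqP; nia.
by rewrite d1 in kd; exact: lin_homz (kerz1_lin sk kd).
Qed.

(** The defect [g] takes values modulo 2 and has period [p]. If [g a] were odd, then [g] would be
    odd at all odd multiples of [a], as [1 + x + x ^ 2] is odd; but at [p * a] it equals [g 0],
    which is even. *)
Lemma skewz_double_homz p f : odd p -> homz p f -> skewz (2 * p) f ->
  kerz (2 * p) f p -> homz (2 * p) f.
Proof.
move=> podd hp sk kp; have p0 : (0 < p)%N by case: p podd {hp sk kp}.
have n0 : (0 < 2 * p)%N by rewrite muln_gt0.
have [u [e [g [[e0 fu gE _] [gp gD fD _]]]]] := kerz_extension n0 sk erefl kp hp.
have g0 : eqm 2 (g 0) 0.
  apply/(@eqm_scale p) => //; rewrite -[p%:Z * g 0]add0r -gE mulr0.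
  exact: (iter_skewz0 sk).
suff gz a : eqm 2 (g a) 0.
  move=> a b; have [x fx] := fD a.
  have guz : eqm (2 * p) (p%:Z * (u * (x%:Z * g b))) (p%:Z * 0).
    by apply/eqm_scale; rewrite // gz !mulr0.
  by rewrite fx -mulrA guz mulr0 addr0.
have [x gx] := gD a.
have gk (k : nat) : eqm 2 (g (a * k.+1%:Z)) (g a + x%:Z * g (a * k%:Z)).
  by rewrite intS mulrDr mulr1 gx.
have [//|ga1] : eqm 2 (g a) 0 \/ eqm 2 (g a) 1 by rewrite /eqm; lia.
have godd (k : nat) : eqm 2 (g (a * (k.*2.+1)%:Z)) 1.
  elim: k => [|k IH]; first by rewrite mulr1.
  rewrite doubleS gk gk IH ga1.
  have -> : 1 + x%:Z * (1 + x%:Z * 1) = 1 + (x * x.+1)%N%:Z by lia.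
  by have : ~~ odd (x * x.+1); [rewrite oddM andbN | rewrite /eqm; lia].
have [k pE] : exists k, p = k.*2.+1 by exists p./2; lia.
by have := godd k; rewrite -pE mulrC -[_ * a]add0r gp g0.
Qed.

(** The kernel contains 2, the only [d] with [4 = q * d] and [q] prime. Injectivity makes [f 1] odd
    and [f 2] nonzero, hence the multiplier [u] odd; the residue of [f 1] then decides the sign. *)
Lemma skewz4_sign f : skewz 4 f -> exists eps : int,
  (eps = 1 \/ eps = -1) /\ forall a, eqm 4 (f a) (eps * a).
Proof.
move=> sk; have [q [d [pq qd kd]]] := @prime_kerz 4 f isT sk isT.
have d2 : d = 2%N /\ q = 2%N.
  have : (q %| 2 ^ 2)%N by rewrite [(2 ^ 2)%N]qd dvdn_mulr.
  by rewrite Euclid_dvdX // dvdn_prime2 // => /andP[/eqP q2 _]; move: qd; rewrite q2; lia.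
case: d2 => d2 q2; rewrite {}d2 {}q2 in qd kd.
have [u fu] := kerz_quotient_multiplier (isT : (0 < 4)%N) sk qd kd.
have f0 := skewz0 sk.
have f1 : ~ eqm 2 (f 1) 0.
  have sk2 := skewz_quotient (isT : (0 < 4)%N) sk qd kd.
  by rewrite -(skewz0 sk2) => /(skewz_inj sk2).
have f2 : ~ eqm 4 (f 2%:Z) 0 by rewrite -f0 => /(skewz_inj sk).
have := fu 0 1; rewrite add0r !mulr1 f0 => fu2.
exists (if (4 %| f 1 - 1)%Z then 1 else -1); split; first by case: ifP; [left|right].
move=> a; have [k ak] : exists k, a = 0 + 2 * k \/ a = 1 + 2 * k.
  by exists (a %/ 2)%Z; lia.
have [w uw] : exists w, u = 1 + 2 * w.
  exists (u %/ 2)%Z; move: f2; rewrite fu2 /eqm; lia.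
have [v fv] : exists v, f 1 = (if (4 %| f 1 - 1)%Z then 1 else -1) + 4 * v.
  move: (f 1) f1 => x; rewrite /eqm; case: ifP => x4 x2; clear -x4 x2.
    by exists ((x - 1) %/ 4)%Z; lia.
  by exists ((x + 1) %/ 4)%Z; lia.
move: fv; set eps := if _ then _ else _ => fv.
have [t et] : exists t, eps = 1 + 2 * t.
  by rewrite /eps; case: ifP; [exists 0 | exists (-1)].
case: ak => ->; rewrite fu uw ?f0 ?fv et; apply: eqm_lin.
  by instantiate (1 := k * w - k * t); ring.
by instantiate (1 := v + k * w - k * t); ring.
Qed.

Lemma eqm_mulI (p : nat) c a b : prime p -> ~ eqm p c 0 ->
  eqm p (a * c) (b * c) -> eqm p a b.
Proof.
move=> pp c0; rewrite /eqm -mulrBl => /(prime_dvdzM pp)[] //.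
by rewrite -eqm0.
Qed.

Lemma eqm_double p a b : odd p -> eqm 2 a b -> eqm p a b -> eqm (2 * p) a b.
Proof. by move=> po; rewrite /eqm PoszM Gauss_dvdz ?coprimezE ?coprime2n // => -> ->. Qed.

(** The prime cofactor is [p], which gives 4 at once, or 2. In the latter case [f] is linear on even
    numbers, and the exponent attached to 1 carries the same multiplier to the odd ones, so that
    even 2 lies in the kernel. *)
Lemma skewz_kerz4 p f : prime p -> odd p -> skewz (4 * p) f ->
  kerz (4 * p) f 4%:Z.
Proof.
move=> pp po sk; have p0 := prime_gt0 pp.
have p40 : (0 < 4 * p)%N by lia.
have p20 : (0 < 2 * p)%N by lia.
have [|q [d [pq qd kd]]] := prime_kerz p40 sk; first by lia.
have [q2|q2] := eqVneq q 2%N; last first.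
  have : (q %| 2 ^ 2 * p)%N by rewrite [(2 ^ 2 * p)%N]qd dvdn_mulr.
  rewrite Euclid_dvdM // Euclid_dvdX // !dvdn_prime2 // (negbTE q2) /= => /eqP qp.
  have d4 : d = 4%N by apply/eqP; rewrite -(eqn_pmul2l p0) -{1}qp -qd mulnC.
  by rewrite d4 in kd.
have {q qd pq q2} d2p : d = (2 * p)%N by move: qd; rewrite q2; lia.
rewrite {}d2p in kd.
have n4 : (4 * p = 2 * (2 * p))%N by lia.
have n4' : (4 * p = 2 * p * 2)%N by lia.
have sk2p := skewz_quotient p40 sk n4 kd.
have k2 : kerz (2 * p) f 2%:Z.
  have [|r [c [pr rc kc]]] := prime_kerz p20 sk2p; first by lia.
  have [r2|r2] := eqVneq r 2%N.
    have cp : c = p by move: rc; rewrite r2; lia.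
    rewrite cp in kc.
    have skp := skewz_quotient p20 sk2p erefl kc.
    by move=> b; exact: skewz_double_homz (skewz_prime_homz pp skp) sk2p kc _ _.
  have : (r %| 2 * p)%N by rewrite rc dvdn_mulr.
  rewrite Euclid_dvdM // !dvdn_prime2 // (negbTE r2) /= => /eqP rp.
  have c2 : c = 2%N by apply/eqP; rewrite -(eqn_pmul2l p0) -{1}rp -rc mulnC.
  by rewrite c2 in kc.
have sk2 := skewz_quotient p20 sk2p (mulnC 2 p) k2.
(* As 2 is in the kernel modulo [2 * p], [f] preserves even numbers. Halving its restriction turns
   modulus [4 * p] into [2 * p], and the kernel element [2 * p] into [p]. *)
pose f' t := (f (2%:Z * t) %/ 2)%Z.
have fE t : f (2%:Z * t) = 2%:Z * f' t.
  rewrite [RHS]mulrC divzK //; apply/eqm0; rewrite -(skewz0 sk2).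
  by apply: (skewz_eqm sk2); rewrite eqm0 dvdz_mulr.
have iterE k t : iter k f (2%:Z * t) = 2%:Z * iter k f' t.
  by elim: k => // k IH; rewrite !iterS IH fE.
have scale a b : eqm (4 * p) (2%:Z * a) (2%:Z * b) <-> eqm (2 * p) a b.
  by rewrite n4'; exact: eqm_scale.
have sk' : skewz (2 * p) f'.
  split=> [a b ab||| a].
  - by apply/scale; rewrite -!fE; apply: (skewz_eqm sk); apply/scale.
  - have [M [M0 fM]] := skewz_period sk; exists M; split=> // a.
    by apply/scale; rewrite -iterE.
  - by apply/scale; rewrite -fE mulr0; exact: skewz0.
  - have [j [j0 fj]] := skewzD sk (2%:Z * a); exists j; split=> // b.
    by apply/scale; rewrite mulrDr -!fE -iterE mulrDr.
have kp' : kerz (2 * p) f' p.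
  by move=> b; apply/scale; rewrite mulrDr -!fE mulrDr -PoszM.
have skp' := skewz_quotient p20 sk' erefl kp'.
have h' := skewz_double_homz po (skewz_prime_homz pp skp') sk' kp'.
have f'E := kerz1_lin sk' (h' 1); set u := f' 1 in f'E.
have f2E t : eqm (4 * p) (f (2%:Z * t)) (2%:Z * (u * t)).
  by rewrite fE; apply/scale.
have iterE' k t : eqm (4 * p) (iter k f (2%:Z * t)) (2%:Z * (u ^+ k * t)).
  rewrite iterE; apply/scale; elim: k => [|k IH]; first by rewrite expr0 mul1r.
  by rewrite iterS IH f'E exprS mulrA.
have f2 : eqm (4 * p) (f 2%:Z) (2%:Z * u) by have := f2E 1; rewrite !mulr1.
have [j [j0 fj]] := skewzD sk 1.
(* Modulo 2 this is a parity check using [0 < j]; modulo [p] it compares two expansions of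
   [f (1 + 2)]. *)
have uj : eqm (2 * p) (u ^+ j) u.
  apply: eqm_double => //.
    have [u0|u1] : eqm 2 u 0 \/ eqm 2 u 1 by rewrite /eqm; lia.
      by rewrite (eqm_expr j u0) u0 expr0n eqn0Ngt j0.
    by rewrite (eqm_expr j u1) u1 expr1n.
  have d42 : (2 * p %| 4 * p)%N by rewrite n4 dvdn_mull.
  have := eqm_dvd d42 (fj (2%:Z * 1)).
  rewrite (eqm_dvd d42 (iterE' j 1)) (kerz_lin k2) (eqm_dvd d42 f2).
  by move=> /eqm_addI; rewrite !mulr1 (mulnC 2 p) => /eqm_scale/eqm_sym; apply.
have fodd t : eqm (4 * p) (f (1 + 2%:Z * t)) (f 1 + 2%:Z * (u * t)).
  by rewrite fj iterE'; have /scale-> : eqm (2 * p) (u ^+ j * t) (u * t) by rewrite uj.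
rewrite (_ : 4%:Z = 2%:Z * 2%:Z) //; apply: (kerzM sk) => b.
have [t [->|->]] : exists t, b = 2%:Z * t \/ b = 1 + 2%:Z * t by exists (b %/ 2)%Z; lia.
  rewrite -[X in f (X + _)](mulr1 2%:Z) -mulrDr !f2E f2.
  by apply: (@eqm_lin _ 0); ring.
rewrite addrCA -[X in f (_ + (X + _))](mulr1 2%:Z) -mulrDr !fodd f2.
by apply: (@eqm_lin _ 0); ring.
Qed.

(** * Classification of the non-additive skew morphisms *)

Definition xy_like (p : nat) (f : int -> int) (s : int) := forall t,
  eqm (4 * p) (f (2 * t + 1)) (2 * t + 1 + s) /\ eqm (4 * p) (f (2 * t)) (2 * t).

Definition z_like (p : nat) (f : int -> int) (w s : int) := forall t,
  [/\ eqm (4 * p) (f (4 * t + 1)) (4 * t + 1 + s),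
      eqm (4 * p) (f (4 * t + 2)) (4 * t + 2 + s * (w + 1)),
      eqm (4 * p) (f (4 * t + 3)) (4 * t + 3 + s * w) &
      eqm (4 * p) (f (4 * t)) (4 * t)].

(** The defect [g] of period 4 is governed by [c = g 1] and [x]. If [f] is 1 modulo 4, then
    [f b = b + 4 * g b] and either root type occurs. If [f] is -1 modulo 4, only [x = -1] survives,
    with shift [f 1 - 1]. *)
Lemma skewz_classification p f : prime p -> odd p -> skewz (4 * p) f ->
  ~ homz (4 * p) f ->
  (exists2 s, (2 %| s)%Z & xy_like p f s) \/
  (exists w c, [/\ ~ eqm p c 0, eqm p (w ^+ 2) (-1) & z_like p f w (4%:Z * c)]).
Proof.
move=> pp po sk nhom; have p0 := prime_gt0 pp.
have p40 : (0 < 4 * p)%N by lia.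
have k4 := skewz_kerz4 pp po sk.
have nE := mulnC 4 p.
have [eps [epsV feps]] := skewz4_sign (skewz_quotient p40 sk nE k4).
have [u [e [g [[e0 fu gE emin] [gp gD fD gf]]]]] :=
  kerz_extension p40 sk nE k4 (lin_homz feps).
have scale a b : eqm (4 * p) (4%:Z * a) (4%:Z * b) <-> eqm p a b.
  by rewrite nE; exact: eqm_scale.
have g0 : eqm p (g 0) 0.
  by apply/scale; rewrite -[4%:Z * g 0]add0r -gE mulr0; exact: (iter_skewz0 sk).
have [x gx] := gD 1; set c := g 1 in gx.
have g2 : eqm p (g 2%:Z) (c + x%:Z * c) by exact: (gx 1).
have g3 : eqm p (g 3%:Z) (c + x%:Z * (c + x%:Z * c)) by rewrite -g2; exact: (gx 2%:Z).
have g4 : eqm p (c + x%:Z * (c + x%:Z * (c + x%:Z * c))) 0.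
  by rewrite -g3 -(gx 3%:Z) -g0; exact: (gp 0 1).
have mod4 a : exists t, a = 0 + 4%:Z * t \/ a = 1 + 4%:Z * t \/
    a = 2%:Z + 4%:Z * t \/ a = 3%:Z + 4%:Z * t by exists (a %/ 4)%Z; lia.
(* If [c] vanished, so would [g] on all four classes, and [fD] would make [f] additive. *)
have c0 : ~ eqm p c 0.
  move=> c0; apply: nhom => a b.
  have gb : eqm p (g b) 0.
    have [t [->|[->|[->|->]]]] := mod4 b;
      by rewrite gp ?g0 ?g2 ?g3 -/c ?c0 ?mulr0 ?addr0 ?mulr0.
  have [y fy] := fD a; rewrite fy -mulrA.
  have /scale-> : eqm p (u * (y%:Z * g b)) 0 by rewrite gb !mulr0.
  by rewrite mulr0 addr0.
have xE : eqm p x (-1) \/ eqm p (x%:Z ^+ 2) (-1).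
  move: g4; rewrite eqm0.
  have -> : c + x%:Z * (c + x%:Z * (c + x%:Z * c))
      = c * ((x%:Z + 1) * (x%:Z ^+ 2 + 1)) by ring.
  case/(prime_dvdzM pp); first by rewrite -eqm0.
  by case/(prime_dvdzM pp); [left | right]; rewrite /eqm opprK.
have gfE a b : eqm 4 (f a) b -> eqm p (g b) (u * g a).
  move=> /dvdzP[k fa]; rewrite -gf -(gp b k).
  by rewrite (_ : b + _ = f a) // -[f a](subrK b) fa; ring.
have gg3' : eqm p (x%:Z ^+ 2) (-1) -> eqm p (g 3%:Z) (x%:Z * c).
  move=> xE'; rewrite g3; apply: (@eqm_trans _ _ (c + x%:Z * c + x%:Z ^+ 2 * c)).
    by apply: (@eqm_lin _ 0); ring.
  by rewrite xE' mulN1r addrAC subrr add0r.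
have half t : exists k, t = 2%:Z * k \/ t = 1 + 2%:Z * k by exists (t %/ 2)%Z; lia.
have two0 : ~ eqm p 2%:Z 0.
  by rewrite eqm0 dvdzE /= dvdn_prime2 // => /eqP p2; move: po; rewrite p2.
case: epsV => epsE; rewrite {}epsE in feps.
  have u1 : eqm p u 1.
    apply: (eqm_mulI pp c0); rewrite mul1r; apply: eqm_sym.
    by apply: (gfE 1 1); rewrite feps.
  have fE b : f b = b + 4%:Z * g b.
    (* Here [f] is trivial modulo 4 and [u] is 1 modulo [p], so the first iterate already
       qualifies. *)
    have e1 : (e %| 1)%N.
      by apply: emin => [b'|] //=; rewrite ?feps ?mul1r ?expr1.
    by move: e1; rewrite dvdn1 => /eqP e1; rewrite -gE e1.
  have fv b v t a r : eqm p (g b) v -> a = b + 4%:Z * t -> r = a + 4%:Z * v ->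
      eqm (4 * p) (f a) r.
    move=> gb -> ->; rewrite fE.
    by have /scale-> : eqm p (g (b + 4%:Z * t)) v by rewrite gp.
  case: xE => xE.
    left; exists (4%:Z * c); first by rewrite dvdz_mulr.
    have gg2 : eqm p (g 2%:Z) 0 by rewrite g2 xE mulN1r subrr.
    have gg3 : eqm p (g 3%:Z) c by rewrite g3 xE !mulN1r subrr subr0.
    move=> t; have [k [->|->]] := half t; split.
    - by apply: (fv 1 c k) => //; ring.
    - by apply: (fv 0 0 k) => //; ring.
    - by apply: (fv 3%:Z c k) => //; ring.
    - by apply: (fv 2%:Z 0 k) => //; ring.
  right; exists x%:Z, c; split=> // t; split.
  - by apply: (fv 1 c t) => //; ring.
  - apply: (fv 2%:Z (c * (x%:Z + 1)) t) => //; try ring.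
    by rewrite g2; apply: (@eqm_lin _ 0); ring.
  - by apply: (fv 3%:Z (c * x%:Z) t) => //; [rewrite gg3' // mulrC | ring | ring].
  - by apply: (fv 0 0 t) => //; ring.
have f1 : eqm 4 (f 1) 3%:Z by rewrite feps.
have f3 : eqm 4 (f 3%:Z) 1 by rewrite feps.
have g31 := gfE _ _ f1; have g13 := gfE _ _ f3; rewrite -/c in g31 g13.
(* If [x ^+ 2 = -1], swapping the classes 1 and 3 gives [u = x] and
   [c = u * g 3 = x ^+ 2 * c = - c], impossible for odd [p]. *)
case: xE => xE; last first.
  have gg3 := gg3' xE.
  have ux : eqm p u x by apply: (eqm_mulI pp c0); rewrite -g31.
  have : eqm p 1 (-1).
    apply: (eqm_mulI pp c0); rewrite mul1r {1}g13 gg3 ux -xE.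
    by apply: (@eqm_lin _ 0); ring.
  by rewrite /eqm opprK -eqm0.
left; exists (f 1 - 1).
  by have := eqm_dvd (isT : 2 %| 4)%N f1; rewrite /eqm; lia.
have gg2 : eqm p (g 2%:Z) 0 by rewrite g2 xE mulN1r subrr.
have gg3 : eqm p (g 3%:Z) c by rewrite g3 xE !mulN1r subrr subr0.
have u1 : eqm p u 1 by apply: (eqm_mulI pp c0); rewrite mul1r -g31.
have e2 : e = 2%N.
  have /dvdn_leq : (e %| 2)%N.
    apply: emin => [b|]; last by rewrite expr2 !u1.
    by rewrite /= !feps mulN1r mulN1r opprK.
  have : e <> 1%N by move=> e1; have := gE 1; move: f1; rewrite e1 /= /eqm; lia.
  lia.
have u1k k : eqm (4 * p) (4%:Z * u * k) (4%:Z * k).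
  by rewrite -mulrA; apply/scale; rewrite u1 mul1r.
(* Writing [f 2 = 2 + 4 * k], the second iterate sends 2 to [2 + 8 * k]; it also fixes 2 since
   [e = 2] and [g 2 = 0]. So [2 * k] is 0 modulo [p]. *)
have f22 : eqm (4 * p) (f 2%:Z) 2%:Z.
  have /dvdzP[k fk] : eqm 4 (f 2%:Z) 2%:Z by rewrite feps.
  have {}fk : f 2%:Z = 2%:Z + 4%:Z * k by rewrite -[f _](subrK 2%:Z) fk; ring.
  suff k0 : eqm p k 0.
    by rewrite fk; have /scale-> : eqm p k 0; rewrite // mulr0 addr0.
  apply: (eqm_mulI pp two0); rewrite mul0r; apply/scale/(@eqm_addI _ 2%:Z).
  have /scale/eqm_sym-> : eqm p (g 2%:Z) 0 by [].
  rewrite -gE e2 /= [in f (f _)]fk fu u1k fk.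
  by apply: (@eqm_lin _ 0); ring.
have f33 : eqm (4 * p) (f 3%:Z) (f 1 + 2%:Z).
  have [y fy] := fD 1; have := fy 2%:Z; rewrite u1k f22.
  have /scale-> : eqm p (y%:Z * g 2%:Z) 0 by rewrite gg2 mulr0.
  by rewrite mulr0 addr0.
have fv b v t a r : eqm (4 * p) (f b) v -> a = b + 4%:Z * t -> r = v + 4%:Z * t ->
    eqm (4 * p) (f a) r.
  by move=> fb -> ->; rewrite fu u1k fb.
move=> t; have [k [->|->]] := half t; split.
- by apply: (fv 1 (f 1) k) => //; ring.
- by apply: (fv 0 0 k (2 * (2%:Z * k))); [exact: skewz0 | ring | ring].
- by apply: (fv 3%:Z (f 1 + 2%:Z) k) => //; ring.
- by apply: (fv 2%:Z 2%:Z k) => //; ring.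
Qed.

(** * The listed maps satisfy the skew law; when they are additive *)

Definition skew_law n (f : int -> int) := forall a, exists j, (0 < j)%N /\
  forall b, eqm n (f (a + b)) (f a + iter j f b).

(** Additivity at [1 + 1] forces [2 * s = 0] modulo [4 * p]; conversely [f] is then multiplication
    by [1 + s]. This accounts for the excluded shifts 0 and [2 * p]. *)
Lemma xy_like_homz p f s : (0 < p)%N -> xy_like p f s ->
  homz (4 * p) f <-> eqm (2 * p) s 0.
Proof.
move=> p0 fP.
have scale a b : eqm (4 * p) (2%:Z * a) (2%:Z * b) <-> eqm (2 * p) a b.
  by rewrite (_ : (4 * p = 2 * p * 2)%N); [exact: eqm_scale | lia].
split=> [hf|/scale s0].
  have [_ f2] := fP 1; have [f1 _] := fP 0.
  have := hf (2 * 0 + 1) (2 * 0 + 1).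
  rewrite (_ : 2 * 0 + 1 + (2 * 0 + 1) = 2 * 1) // f2 f1 => E; apply/scale.
  apply: (@eqm_addI _ 2).
  by rewrite mulr0 addr0 -[X in eqm _ _ X](mulr1 2) E; apply: (@eqm_lin _ 0); ring.
apply: (@lin_homz _ _ (1 + s)) => a.
have [t [->|->]] : exists t, a = 2 * t \/ a = 2 * t + 1 by exists (a %/ 2)%Z; lia.
  rewrite (fP t).2 (_ : (1 + s) * (2 * t) = 2 * t + 2%:Z * s * t); last by ring.
  by rewrite s0 mulr0 mul0r addr0.
rewrite (fP t).1 (_ : (1 + s) * (2 * t + 1) = 2 * t + 1 + s + 2%:Z * s * t); last by ring.
by rewrite s0 mulr0 mul0r addr0.
Qed.

(** The map moves only odd numbers, by an even shift. Exponent 1 serves even [a]; for odd [a] the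
    inverse of [f] is required, written as the positive exponent [4 * p - 1]. *)
Lemma xy_like_skew p f s : (0 < p)%N ->
  Proper (eqm (4 * p) ==> eqm (4 * p)) f -> (2 %| s)%Z ->
  xy_like p f s -> skew_law (4 * p) f.
Proof.
move=> p0 f_proper /dvdzP[r sE] fP.
have fev a t : a = 2 * t -> eqm (4 * p) (f a) a by move=> ->; exact: (fP t).2.
have fodd a t : a = 2 * t + 1 -> eqm (4 * p) (f a) (a + s) by move=> ->; exact: (fP t).1.
have iev j a t : a = 2 * t -> eqm (4 * p) (iter j f a) a.
  by move=> aE; elim: j => // j IH; rewrite iterS IH; exact: fev aE.
have iodd j a t : a = 2 * t + 1 -> eqm (4 * p) (iter j f a) (a + s * j%:Z).
  move=> aE; elim: j => [|j IH]; first by rewrite mulr0 addr0.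
  rewrite iterS IH (@fodd _ (t + r * j%:Z)); last by rewrite aE sE; ring.
  by rewrite intS; apply: (@eqm_lin _ 0); ring.
have par (a : int) : exists t, a = 2 * t \/ a = 2 * t + 1 by exists (a %/ 2)%Z; lia.
move=> a; have [t [aE|aE]] := par a.
  exists 1%N; split=> // b; have [v [bE|bE]] := par b.
    by rewrite /= (fev a t) // (fev b v) // (fev _ (t + v)) // aE bE; ring.
  rewrite /= (fev a t) // (fodd b v) // (fodd _ (t + v)) ?addrA //.
  by rewrite aE bE; ring.
exists (4 * p).-1; split=> [|b]; first by lia.
rewrite (fodd a t) //; have [v [bE|bE]] := par b.
  rewrite (iev _ b v) // (fodd _ (t + v)); last by rewrite aE bE; ring.
  by apply: (@eqm_lin _ 0); ring.
rewrite (iodd _ b v) // (fev _ (t + v + 1)); last by rewrite aE bE; ring.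
have pE : (4 * p).-1%:Z = (4 * p)%N%:Z - 1 by lia.
by apply: (@eqm_lin _ (- s)); rewrite pE; ring.
Qed.

(** If [p] were 3 modulo 4, then [p = 2 * k + 1] with [k] odd, and Fermat would give
    [a = a ^ p = - a], hence [a = 0]. *)
Lemma sqr_opp1_mod4 p w : prime p -> odd p -> eqm p (w ^+ 2) (-1) -> (p %% 4 = 1)%N.
Proof.
move=> pp po w2; have p0 := prime_gt0 pp.
have [//|p3] : (p %% 4 = 1 \/ p %% 4 = 3)%N by lia.
have [a [_ wa]] := eqm_small_nat p0 w.
have a2 : eqm p (a%:Z ^+ 2) (-1) by rewrite -w2; apply: eqm_expr; apply: eqm_sym.
have ap : eqm p (a%:Z ^+ p) a.
  have -> : a%:Z ^+ p = (a ^ p)%N%:Z by rewrite -!natz natrX.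
  by apply/eqm_mod; rewrite !modz_nat fermat_little.
have pE : (p = (p %/ 4).*2.+1 * 2 + 1)%N by lia.
move: ap; rewrite {2}pE addn1 exprSr mulnC exprM (eqm_expr _ a2).
rewrite -signr_odd /= odd_double expr1 mulN1r.
have two0 : ~ eqm p 2%:Z 0.
  by rewrite eqm0 dvdzE /= dvdn_prime2 // => /eqP p2; move: po; rewrite p2.
move=> aa; have a0 : eqm p a 0.
  apply: (eqm_mulI pp two0); rewrite mul0r; apply: (@eqm_addI _ (- a%:Z)).
  by rewrite addr0 (_ : - a%:Z + a%:Z * 2%:Z = a); [exact: eqm_sym | ring].
move: a2; rewrite expr2 a0 mul0r => /eqm_sym; rewrite eqm0 dvdzE dvdn1 /= => /eqP p1.
by move: pp; rewrite p1.
Qed.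

(** Additivity at [1 + 1] forces [w = 1] modulo [p], against [w ^+ 2 = -1]. *)
Lemma z_like_not_homz p f w c : prime p -> odd p -> ~ eqm p c 0 ->
  eqm p (w ^+ 2) (-1) -> z_like p f w (4%:Z * c) -> ~ homz (4 * p) f.
Proof.
move=> pp po c0 w2 fP hf.
have [f1 f2 _ _] := fP 0; have := hf (4 * 0 + 1) (4 * 0 + 1).
rewrite (_ : 4 * 0 + 1 + (4 * 0 + 1) = 4 * 0 + 2) // f2 f1 => E.
have : eqm (4 * p) (4%:Z * (w * c)) (4%:Z * (1 * c)).
  apply: (@eqm_addI _ (2 + 4%:Z * c)).
  rewrite (_ : _ + 4%:Z * (w * c) = 4 * 0 + 2 + 4%:Z * c * (w + 1)); last by ring.
  by rewrite E; apply: (@eqm_lin _ 0); ring.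
rewrite mulnC => /eqm_scale-/(_ isT)/(eqm_mulI pp c0) w1.
move: w2; rewrite expr2 w1 mulr1 /eqm opprK dvdzE /= dvdn_prime2 // => /eqP p2.
by move: po; rewrite p2.
Qed.

Lemma z_like_skew p f w c : (0 < p)%N ->
  Proper (eqm (4 * p) ==> eqm (4 * p)) f -> eqm p (w ^+ 2) (-1) ->
  z_like p f w (4%:Z * c) -> skew_law (4 * p) f.
Proof.
move=> p0 f_proper /dvdzP[m w2] fP.
(* Modulo [p], [W r] is the power of [w] with exponent [r], and [G r] is the geometric sum of the
   first [r] powers. The skew law reduces to [G (r + r') = G r + W r * G r'], with indices modulo
   4. *)
pose G r := nth 0 [:: 0; 1; w + 1; w] r; pose W r := nth 0 [:: 1; w; -1; - w] r.
have scale a b : eqm (4 * p) (4%:Z * a) (4%:Z * b) <-> eqm p a b.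
  by rewrite mulnC; exact: eqm_scale.
have res (a : int) : exists (r : nat) (t : int), (r < 4)%N /\ a = r%:Z + 4 * t.
  by exists `|(a %% 4)%Z|%N, (a %/ 4)%Z; lia.
have fE r t a : (r < 4)%N -> a = r%:Z + 4 * t ->
    eqm (4 * p) (f a) (a + 4%:Z * (c * G r)).
  have [f1 f2 f3 f0] := fP t; rewrite [_ + 4 * t]addrC mulrA.
  by case: r => [|[|[|[|]]]] // _ ->; rewrite /G /= ?mulr0 ?mulr1 ?addr0.
have iterE j r t a : (r < 4)%N -> a = r%:Z + 4 * t ->
    eqm (4 * p) (iter j f a) (a + 4%:Z * (c * (j%:Z * G r))).
  move=> r4 aE; elim: j => [|j IH]; first by rewrite mul0r !mulr0 addr0.
  rewrite iterS IH (@fE r (t + c * (j%:Z * G r))) //; last by rewrite aE; ring.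
  by rewrite intS; apply: (@eqm_lin _ 0); ring.
move=> a; have [r [t [r4 aE]]] := res a.
have [j [j0 jW]] : exists j : nat, (0 < j)%N /\ eqm p j (W r).
  have [k [_ kW]] := eqm_small_nat p0 (W r).
  (* Adding [p] keeps the residue and makes the exponent positive. *)
  by exists (k + p)%N; split; [lia | rewrite kW; apply: (@eqm_lin _ 1); lia].
exists j; split=> // b; have [r' [t' [r'4 bE]]] := res b.
rewrite (fE r t a) // (iterE j r' t' b) //.
rewrite (fE ((r + r') %% 4)%N (t + t' + ((r + r') %/ 4)%N%:Z) (a + b)).
- have /scale-> : eqm p (c * G ((r + r') %% 4)%N) (c * (G r + W r * G r')).
    suff -> : eqm p (G ((r + r') %% 4)%N) (G r + W r * G r') by [].
    move: r4 r'4; rewrite /G /W.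
    case: r {aE fE iterE jW} => [|[|[|[|]]]] //; case: r' {bE} => [|[|[|[|]]]] //= _ _;
      by [apply: (@eqm_lin _ 0); ring | apply: (@eqm_lin _ m); lia
         | apply: (@eqm_lin _ (- m)); lia].
  have /scale-> : eqm p (c * (j%:Z * G r')) (c * (W r * G r')) by rewrite jW.
  by apply: (@eqm_lin _ 0); ring.
- by rewrite ltn_mod.
by rewrite aE bE; lia.
Qed.

(** * Discrete logarithms to base [b] *)

Section Logarithm.

Variables (gT : finGroupType) (b : gT) (n : nat).
Hypotheses (gen_b : generator [set: gT] b) (card_gT : #|gT| = n).

Let b_order : #[b]%g = n.
Proof. by rewrite -card_gT -cardsT (eqP gen_b). Qed.

Let n_gt0 : (0 < n)%N. Proof. by rewrite -b_order order_gt0. Qed.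

Lemma zexpg_eqm k l : zexpg b k = zexpg b l <-> eqm n k l.
Proof.
rewrite eqm_mod -b_order; split=> /eqP E; apply/eqP.
  by rewrite -eq_zexpg.
by rewrite eq_zexpg.
Qed.

Lemma zexpgD k l : zexpg b (k + l) = (zexpg b k * zexpg b l)%g.
Proof.
have [i [_ ki]] := eqm_small_nat n_gt0 k; have [j [_ lj]] := eqm_small_nat n_gt0 l.
have /zexpg_eqm-> : eqm n (k + l) (i + j)%N by rewrite ki lj PoszD.
by move/zexpg_eqm: ki => ->; move/zexpg_eqm: lj => ->; rewrite /= expgD.
Qed.

Variable phi : {perm gT}.

(** The exponent is an arbitrary choice, meaningful only modulo [n]. *)
Definition logperm (k : int) : int :=
  xchoose (zexpg_onto gen_b (phi (zexpg b k))).

Lemma logpermE k : phi (zexpg b k) = zexpg b (logperm k).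
Proof. by rewrite /logperm (eqP (xchooseP (zexpg_onto gen_b _))). Qed.

Lemma iter_logpermE j k : (phi ^+ j)%g (zexpg b k) = zexpg b (iter j logperm k).
Proof. by rewrite permX; elim: j => //= j ->; rewrite logpermE. Qed.

Lemma logperm_proper : Proper (eqm n ==> eqm n) logperm.
Proof. by move=> k l /zexpg_eqm kl; apply/zexpg_eqm; rewrite -!logpermE kl. Qed.

Lemma skew_morphism_log :
  skew_morphism phi <-> eqm n (logperm 0) 0 /\ skew_law n logperm.
Proof.
have onto g : exists k, g = zexpg b k.
  by have [k /eqP <-] := zexpg_onto gen_b g; exists k.
have phi1 : phi 1%g = 1%g <-> eqm n (logperm 0) 0.
  by rewrite -zexpg_eqm -logpermE.
split=> -[/phi1 fix0 skew]; split=> // a.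
  have [j [j0 fj]] := skew (zexpg b a); exists j; split=> // c.
  by apply/zexpg_eqm; rewrite -logpermE !zexpgD fj logpermE iter_logpermE.
have [k ->] := onto a; have [j [j0 fj]] := skew k; exists j; split=> // c.
have [l ->] := onto c; rewrite -zexpgD !logpermE iter_logpermE -zexpgD.
by apply/zexpg_eqm.
Qed.

Lemma skew_morphism_skewz : skew_morphism phi -> skewz n logperm.
Proof.
case/skew_morphism_log=> f0 fD; split=> //; first exact: logperm_proper.
exists #[phi]%g; split=> [|k]; first exact: order_gt0.
by apply/zexpg_eqm; rewrite -iter_logpermE expg_order perm1.
Qed.

Lemma Aut_log : phi \in Aut [set: gT] <-> homz n logperm.
Proof.
rewrite inE; split=> [/andP[_ /morphicP phiM] k l | hf].
  by apply/zexpg_eqm; rewrite -logpermE !zexpgD phiM ?inE // !logpermE.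
apply/andP; split; first by apply/subsetP=> g; rewrite inE.
apply/morphicP=> g h _ _.
have [k /eqP <-] := zexpg_onto gen_b g; have [l /eqP <-] := zexpg_onto gen_b h.
by rewrite -zexpgD !logpermE -zexpgD; apply/zexpg_eqm.
Qed.

End Logarithm.

(** * Return to permutations of the group *)

Lemma is_xy_perm_log p (gT : finGroupType) (b : gT) (gen_b : generator [set: gT] b)
    (card_gT : #|gT| = (4 * p)%N) s (phi : {perm gT}) :
  is_xy_perm b s phi <-> xy_like p (logperm gen_b phi) s.
Proof.
have E k l : phi (zexpg b k) = zexpg b l <-> eqm (4 * p) (logperm gen_b phi k) l.
  by rewrite (logpermE gen_b); exact: zexpg_eqm.
by split=> H t; have [H1 H2] := H t; split; apply/E.
Qed.

Lemma is_z_perm_log p (gT : finGroupType) (b : gT) (gen_b : generator [set: gT] b)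
    (card_gT : #|gT| = (4 * p)%N) w s (phi : {perm gT}) :
  is_z_perm b w s phi <-> z_like p (logperm gen_b phi) w s.
Proof.
have E k l : phi (zexpg b k) = zexpg b l <-> eqm (4 * p) (logperm gen_b phi k) l.
  by rewrite (logpermE gen_b); exact: zexpg_eqm.
by split=> H t; have [H1 H2 H3 H4] := H t; split; apply/E.
Qed.

Theorem theorem6p3 (p : nat) (gT : finGroupType) (b : gT)
    (p_prime : prime p) (p_odd : odd p)
    (card_gT : #|gT| = (4 * p)%N) (gen_b : generator [set: gT] b)
    (phi : {perm gT}) :
  proper_skew_morphism phi <->
    [\/ exists i : nat,
          [/\ (i < p)%N, i <> ((p - 1) %/ 2)%N
            & is_xy_perm b (4 * i + 2)%N%:Z phi],
        exists i : nat,
          [/\ (0 < i)%N, (i < p)%N & is_xy_perm b (4 * i)%N%:Z phi]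
      | p = 1 %[mod 4] /\
        exists (w : int) (i : nat),
          [/\ (w ^+ 2 = -1 %[mod p])%Z, (0 < i)%N, (i < p)%N
            & is_z_perm b w (4 * i)%N%:Z phi]].
Proof.
have p_gt0 := prime_gt0 p_prime; have p4_gt0 : (0 < 4 * p)%N by lia.
have properE : proper_skew_morphism phi <->
    skew_morphism phi /\ ~ homz (4 * p) (logperm gen_b phi).
  rewrite -(Aut_log gen_b card_gT phi); by split=> -[sk /negP nA].
have xyE s := is_xy_perm_log gen_b card_gT s phi.
have zE w s := is_z_perm_log gen_b card_gT w s phi.
have f_proper := logperm_proper gen_b card_gT phi.
rewrite properE; split=> [[sk nhom]|].
  have [[s s2 fP]|[w [c [c0 w2 fP]]]] :=
    skewz_classification p_prime p_odd (skew_morphism_skewz gen_b card_gT sk) nhom.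
    (* The shift is reduced to an even [r] below [4 * p], so that [i = r %/ 4] is below [p]; failure
       of additivity rules out 0 and [2 * p]. *)
    have [r [r_lt sr]] := eqm_small_nat p4_gt0 s.
    have {}fP : xy_like p (logperm gen_b phi) r.
      by move=> t; have [f1 f0] := fP t; split; rewrite // f1 sr.
    have r2 : ~~ odd r.
      have : eqm 2 s r by apply: eqm_dvd sr; rewrite -[4%N]/(2 * 2)%N -mulnA dvdn_mulr.
      by move: s2; rewrite /eqm; lia.
    have nr : ~ (2 * p %| r)%N.
      by move=> rp; apply: nhom; apply/(xy_like_homz p_gt0 fP)/eqm0.
    have [r4|r4] := boolP (4 %| r)%N.
      apply: Or32; exists (r %/ 4)%N; split; try lia.
        by case: posnP => // r0; case: nr; have -> : r = 0%N by lia.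
      by apply/xyE; rewrite mulnC divnK.
    apply: Or31; exists (r %/ 4)%N; split; first by lia.
      by move=> ri; case: nr; rewrite (_ : r = 2 * p)%N //; lia.
    by apply/xyE; rewrite (_ : 4 * (r %/ 4) + 2 = r)%N //; lia.
  apply: Or33; split; first by rewrite (sqr_opp1_mod4 p_prime p_odd w2).
  have [i [i_lt ci]] := eqm_small_nat p_gt0 c.
  exists w, i; split=> //; first exact/eqm_mod.
    by rewrite lt0n; apply/eqP => i0; apply: c0; rewrite ci i0.
  have ci4 : eqm (4 * p) (4%:Z * c) (4 * i)%N.
    by rewrite mulnC PoszM; apply/eqm_scale.
  by apply/zE => t; have [f1 f2 f3 f0] := fP t; split; rewrite // ?f1 ?f2 ?f3 ci4.
case=> [[i [i_lt ni /xyE fP]]|[i [i_gt0 i_lt /xyE fP]]|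
        [_ [w [i [/eqm_mod w2 i_gt0 i_lt /zE fP]]]]].
- have i2 : (2 %| (4 * i + 2)%N%:Z)%Z by lia.
  have skf := xy_like_skew p_gt0 f_proper i2 fP.
  split; first by apply/(skew_morphism_log gen_b card_gT); split=> //; exact: (fP 0).2.
  rewrite (xy_like_homz p_gt0 fP) eqm0 => /dvdnP[k kE].
  (* In [4 * i + 2 = k * (2 * p)], [k = 0] is impossible, [k = 1] is the excluded index, and larger
     [k] contradict [i < p]. *)
  move: kE; case: k => [|[|k]] /= kE; [lia | apply: ni; lia | nia].
- have i2 : (2 %| (4 * i)%N%:Z)%Z by lia.
  have skf := xy_like_skew p_gt0 f_proper i2 fP.
  split; first by apply/(skew_morphism_log gen_b card_gT); split=> //; exact: (fP 0).2.
  rewrite (xy_like_homz p_gt0 fP) eqm0 => /dvdnP[k kE].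
  have : (p %| 2 * i)%N by apply/dvdnP; exists k; lia.
  rewrite Euclid_dvdM // dvdn_prime2 // => /orP[/eqP p2|/dvdn_leq]; last by lia.
  by move: p_odd; rewrite p2.
rewrite PoszM in fP.
have i0 : ~ eqm p i 0 by rewrite eqm0 => /dvdn_leq; lia.
split; last exact: z_like_not_homz fP.
apply/(skew_morphism_log gen_b card_gT); split; first by case: (fP 0).
exact: z_like_skew fP.
Qed.
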